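(* There exist positive constants $C_{\boldsymbol W}^{\mathfrak n}$, $C_0^{\mathfrak n}$, $C_1^{\mathfrak n}$, depending only on $\{N, m_k, d_k, n_k, \boldsymbol W^{\mathfrak n}, \boldsymbol\eta^{\mathfrak n}\}$ (in particular not on $\Delta t$, $\varepsilon$ or $\ell$), such that for all $\Delta t>0$, $\varepsilon>0$ and all $\ell\ge 1$ the GST iterates satisfy $$\|\Delta^{\ell}\boldsymbol W\|_{\mathrm F}\le C_{\boldsymbol W}^{\mathfrak n}\,\Gamma_{\boldsymbol W}^{\mathfrak n}\,\|\Delta^{\ell-1}\boldsymbol\eta\|_2,$$ $$\|\Delta^{\ell}\boldsymbol\eta\|_2\le C_0^{\mathfrak n}\,\Gamma_{\boldsymbol W}^{\mathfrak n}\,\|\Delta^{\ell-1}\boldsymbol\eta\|_2+C_1^{\mathfrak n}\,\Gamma_{\boldsymbol X}^{\mathfrak n}\,\|\Delta^{\ell-1}\boldsymbol\eta\|_2,$$ where $$\Gamma_{\boldsymbol W}^{\mathfrak n}=\frac{\Delta t\,\varepsilon}{(\varepsilon+\Delta t\, z_{\min}^{\mathfrak n})^2},\qquad \Gamma_{\boldsymbol\eta}^{\mathfrak n}=\frac{\Delta t\,\varepsilon}{(\varepsilon+\Delta t\,\widehat z_{\min}^{\mathfrak n})^2},\qquad \Gamma_{\boldsymbol X}^{\mathfrak n}=\max\{\Gamma_{\boldsymbol W}^{\mathfrak n},\Gamma_{\boldsymbol\eta}^{\mathfrak n}\}.$$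
   Context: Setting. $d$ (velocity dimension) and $N$ (number of species) are positive integers, $\varepsilon>0$, $\Delta t>0$. Species $i\in\{1,\dots,N\}$ has mass $m_i>0$, reference diameter $d_i>0$, number density $n_i>0$, mass density $\rho_i=m_in_i$. Given data at the old time level $\mathfrak n$: velocities $\boldsymbol u_i^{\mathfrak n}\in\mathbb R^d$ and temperatures $T_i^{\mathfrak n}>0$. Sums $\sum_j$ run over $j=1,\dots,N$. Collision quantities. For temperatures $T_1,\dots,T_N>0$ put $\Psi_{i,j}=\sqrt{T_i/m_i+T_j/m_j}$ and $\lambda_{i,j}=c_{i,j}n_j\Psi_{i,j}$ with $c_{i,j}=\frac{32\pi^2}{3(2\pi)^{3/2}}\frac{m_im_j}{(m_i+m_j)^2}(d_i+d_j)^2$. Define $A_{i,j}=\frac{\rho_i\rho_j\lambda_{i,j}\lambda_{j,i}}{\rho_i\lambda_{i,j}+\rho_j\lambda_{j,i}}$, $B_{i,j}=\frac{n_in_j\lambda_{i,j}\lambda_{j,i}}{n_i\lambda_{i,j}+n_j\lambda_{j,i}}$, $D_{i,j}=(\sum_kA_{i,k})\delta_{i,j}$, $F_{i,j}=(\sum_kB_{i,k})\delta_{i,j}$. A superscript $\mathfrak n$ or $\ell$ on these quantities means evaluation at the temperatures $T_i^{\mathfrak n}$ or $T_i^{\ell}$. Also $s_i=|\boldsymbol u_i|^2$, $\boldsymbol u_{i,j}=\frac{\rho_i\lambda_{i,j}\boldsymbol u_i+\rho_j\lambda_{j,i}\boldsymbol u_j}{\rho_i\lambda_{i,j}+\rho_j\lambda_{j,i}}$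 (the common factor $\Psi_{i,j}$ cancels in the weights), $S_{i,j}=|\boldsymbol u_{i,j}|^2$, with superscripts inherited. GST iteration. $\boldsymbol u_i^{0}=\boldsymbol u_i^{\mathfrak n}$, $T_i^{0}=T_i^{\mathfrak n}$, and for $\ell\ge0$ the iterates $\boldsymbol u_i^{\ell+1},T_i^{\ell+1}$ are given by $$\rho_i\frac{\boldsymbol u_i^{\ell+1}-\boldsymbol u_i^{\mathfrak n}}{\Delta t}=\frac1\varepsilon\sum_j(A_{i,j}^{\ell}-D_{i,j}^{\ell})\boldsymbol u_j^{\ell+1},$$ $$\rho_i\frac{s_i^{\ell+1}-s_i^{\mathfrak n}}{\Delta t}+dn_i\frac{T_i^{\ell+1}-T_i^{\mathfrak n}}{\Delta t}=\frac d\varepsilon\sum_j(B_{i,j}^{\ell}-F_{i,j}^{\ell})T_j^{\ell+1}+\frac1\varepsilon\sum_jB_{i,j}^{\ell}\left[m_j(s_j^{\ell+1}-S_{i,j}^{\ell+1})-m_i(s_i^{\ell+1}-S_{i,j}^{\ell+1})\right].$$ Variables. $P=\mathrm{diag}\{\rho_k\}$, $Q=\mathrm{diag}\{n_k\}$; $\boldsymbol U\in\mathbb R^{N\times d}$ has rows $\boldsymbol u_i^\top$, $\boldsymbol T=(T_1,\dots,T_N)^\top$; $\boldsymbol W=P^{1/2}\boldsymbol U$, $\boldsymbol\eta=Q^{1/2}\boldsymbol T$ (with superscripts $\mathfrak n$ or $\ell$). $\Delta^\ell K=K^{\ell+1}-K^\ell$ for any $\ell$-dependent quantity $K$. $\|\cdot\|_{\mathrm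 F}$ is the Frobenius norm, $\|\cdot\|_2$ the Euclidean norm. Constants. $A_{\min}^{\mathfrak n}=\min_{i,j}A_{i,j}^{\mathfrak n}$, $B_{\min}^{\mathfrak n}=\min_{i,j}B_{i,j}^{\mathfrak n}$, $\rho_{\max}=\max_k\rho_k$, $n_{\max}=\max_kn_k$, $z_{\min}^{\mathfrak n}=A_{\min}^{\mathfrak n}N/\rho_{\max}$, $\widehat z_{\min}^{\mathfrak n}=B_{\min}^{\mathfrak n}N/n_{\max}$. *)

(* Defs.v *)
From mathcomp Require Import all_boot all_order all_algebra.
From mathcomp Require Import all_classical all_reals all_analysis.

Set Implicit Arguments.
Unset Strict Implicit.
Unset Printing Implicit Defensive.

Import Order.TTheory GRing.Theory Num.Theory.

Local Open Scope classical_set_scope.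
Local Open Scope ring_scope.

(* `|A| on matrices is the sup norm in this library, hence this definition.
   On a column vector it is the Euclidean norm. *)
Definition frobenius_norm (R : realType) p q (A : 'M[R]_(p, q)) : R :=
  Num.sqrt (\sum_i \sum_j A i j ^+ 2).

Definition euclidean_norm (R : realType) p (v : 'cV[R]_p) : R :=
  Num.sqrt (\sum_i v i 0 ^+ 2).

Definition sqnorm (R : realType) q (x : 'rV[R]_q) : R := \sum_k x 0 k ^+ 2.

(* Over a nonempty finite index type these are the minimum and the maximum,
   see fmin_attained and fmax_attained. *)
Definition fmin (R : realType) (I : finType) (f : I -> R) : R := inf (range f).
Definition fmax (R : realType) (I : finType) (f : I -> R) : R := sup (range f).

Lemma fmin_attained (R : realType) (I : finType) (f : I -> R) (i0 : I) :
  exists2 i, fmin f = f i & forall j, f i <= f j.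
Proof.
have [i _ lei] := @arg_minP _ R I i0 xpredT f isT.
have hlb : lbound (range f) (f i) by move=> _ [j _ <-]; exact: lei.
exists i => [|j]; last exact: lei.
apply/eqP; rewrite eq_le; apply/andP; split.
  by apply: ge_inf; [exists (f i) | exists i].
by apply: lb_le_inf => //; exists (f i), i.
Qed.

Lemma fmax_attained (R : realType) (I : finType) (f : I -> R) (i0 : I) :
  exists2 i, fmax f = f i & forall j, f j <= f i.
Proof.
have [i _ gei] := @arg_maxP _ R I i0 xpredT f isT.
have hub : ubound (range f) (f i) by move=> _ [j _ <-]; exact: gei.
exists i => [|j]; last exact: gei.
apply/eqP; rewrite eq_le; apply/andP; split.
  by apply: ge_sup => //; exists (f i), i.
by apply: ub_le_sup; [exists (f i) | exists i].
Qed.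

(* The difference K^(l+1) - K^l. *)
Definition Delta (V : zmodType) (K : nat -> V) (l : nat) : V := K l.+1 - K l.

Section Mixture.
Context (R : realType) (N : nat).
(* mass, reference diameter, number density *)
Context (m dia n : 'I_N -> R).

Definition rho (i : 'I_N) : R := m i * n i.

Definition ccoef (i j : 'I_N) : R :=
  (32 * pi ^+ 2) / (3 * (2 * pi) `^ (3 / 2))
  * ((m i * m j) / (m i + m j) ^+ 2) * (dia i + dia j) ^+ 2.

Section Temperature.
Context (T : 'cV[R]_N).

Definition Psi (i j : 'I_N) : R := Num.sqrt (T i 0 / m i + T j 0 / m j).

Definition lambda (i j : 'I_N) : R := ccoef i j * n j * Psi i j.

Definition Amx : 'M[R]_N := \matrix_(i, j)
  ((rho i * rho j * lambda i j * lambda j i)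
   / (rho i * lambda i j + rho j * lambda j i)).

Definition Bmx : 'M[R]_N := \matrix_(i, j)
  ((n i * n j * lambda i j * lambda j i)
   / (n i * lambda i j + n j * lambda j i)).

Definition Dmx : 'M[R]_N := \matrix_(i, j) ((\sum_k Amx i k) *+ (i == j)).

Definition Fmx : 'M[R]_N := \matrix_(i, j) ((\sum_k Bmx i k) *+ (i == j)).

Definition Amin : R := fmin (fun p : 'I_N * 'I_N => Amx p.1 p.2).

Definition Bmin : R := fmin (fun p : 'I_N * 'I_N => Bmx p.1 p.2).

Definition zmin : R := Amin * N%:R / fmax rho.

Definition zhatmin : R := Bmin * N%:R / fmax n.

Definition GammaW (dt eps : R) : R := dt * eps / (eps + dt * zmin) ^+ 2.

Definition Gammaeta (dt eps : R) : R := dt * eps / (eps + dt * zhatmin) ^+ 2.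

Definition GammaX (dt eps : R) : R :=
  Num.max (GammaW dt eps) (Gammaeta dt eps).

End Temperature.

Section Velocity.
Context (d : nat) (U : 'M[R]_(N, d)).

Definition sq_speed (i : 'I_N) : R := sqnorm (row i U).

(* The weights are rho_i lambda_{i,j} with the common factor Psi_{i,j}
   cancelled, so that no temperature enters; umix_lambda gives the form with
   lambda at any positive temperatures. *)
Definition umix (i j : 'I_N) : 'rV[R]_d :=
  (rho i * (ccoef i j * n j) + rho j * (ccoef j i * n i))^-1
  *: (rho i * (ccoef i j * n j) *: row i U
      + rho j * (ccoef j i * n i) *: row j U).

Definition Smix (i j : 'I_N) : R := sqnorm (umix i j).

Lemma umix_lambda (T : 'cV[R]_N) (i j : 'I_N) :
  (forall k, 0 < m k) -> (forall k, 0 < T k 0) ->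
  umix i j = (rho i * lambda T i j + rho j * lambda T j i)^-1
             *: (rho i * lambda T i j *: row i U
                 + rho j * lambda T j i *: row j U).
Proof.
move=> m0 T0; rewrite /umix /lambda.
have -> : Psi T j i = Psi T i j by rewrite /Psi addrC.
have P0 : Psi T i j != 0.
  by rewrite gt_eqF// /Psi sqrtr_gt0 addr_gt0// divr_gt0.
move: (Psi T i j) P0 (ccoef i j * n j) (ccoef j i * n i) => p p0 a b.
rewrite !mulrA -mulrDl !(mulrC _ p) -!scalerA -scalerDr.
by rewrite [RHS]scalerA; congr (_ *: _); rewrite invfM [RHS]mulrC mulVKf.
Qed.

End Velocity.

Definition Wmx d (U : 'M[R]_(N, d)) : 'M[R]_(N, d) :=
  diag_mx (\row_k Num.sqrt (rho k)) *m U.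

Definition etavec (T : 'cV[R]_N) : 'cV[R]_N :=
  diag_mx (\row_k Num.sqrt (n k)) *m T.

(* (U, T) are the GST iterates started from the old time level (Un, Tn). *)
Record GST_iterates d (dt eps : R) (Un : 'M[R]_(N, d)) (Tn : 'cV[R]_N)
    (U : nat -> 'M[R]_(N, d)) (T : nat -> 'cV[R]_N) : Prop := {
  GST_U0 : U 0%N = Un;
  GST_T0 : T 0%N = Tn;
  GST_momentum : forall (l : nat) (i : 'I_N),
    rho i *: (dt^-1 *: (row i (U l.+1) - row i Un)) =
    eps^-1 *: \sum_j (Amx (T l) i j - Dmx (T l) i j) *: row j (U l.+1);
  GST_energy : forall (l : nat) (i : 'I_N),
    rho i * ((sq_speed (U l.+1) i - sq_speed Un i) / dt)
    + d%:R * n i * ((T l.+1 i 0 - Tn i 0) / dt) =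
    d%:R / eps * (\sum_j (Bmx (T l) i j - Fmx (T l) i j) * T l.+1 j 0)
    + eps^-1 * (\sum_j Bmx (T l) i j *
        (m j * (sq_speed (U l.+1) j - Smix (U l.+1) i j)
         - m i * (sq_speed (U l.+1) i - Smix (U l.+1) i j)))
}.

End Mixture.

(* Main.v *)
Require Import Defs.
From mathcomp Require Import all_boot all_order all_algebra.
From mathcomp Require Import all_classical all_reals all_analysis.
From mathcomp Require Import ring lra.
Set Implicit Arguments.
Unset Strict Implicit.
Unset Printing Implicit Defensive.

Import Order.TTheory GRing.Theory Num.Theory.
Local Open Scope ring_scope.

(** Write tau = dt / eps. The rates satisfy A_ij = 2 m_i m_j / (m_i + m_j) B_ij
    with B_ij proportional to Psi_ij, and both are symmetric. In terms of the
    energy e_i = m_i |u_i|^2 + d T_i of species i, one sweep of the iteration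
    reads
      rho_i (u_i - u_i^n) = tau sum_j A_ij (u_j - u_i),
      n_i (e_i - e_i^n) = tau sum_j B_ij (e_j - e_i + (m_i - m_j) S_ij),
    where both exchange terms are antisymmetric in (i, j)
    ([exchange_iterates], [GST_exchange]).

    Uniform bounds. Eliminating the kinetic energy with the momentum equation
    turns the energy equation into a heat equation whose sources are squares
    ([pair_heating]); by the minimum principle all iterated temperatures stay
    above the least initial one ([temperature_ge]). With conservation of energy,
    temperatures and velocities are then bounded ([iterates_bounded]). On this
    range the rates are bounded, bounded away from 0 and Lipschitz in the
    temperatures ([collision_bounds]), with constants independent of dt, eps
    and l.

    Relaxation. An exchange system with rates at least c, whose solution has
    weighted mean zero, damps its data by a factor 1 / (c (1 + tau)): this is
    the maximum principle ([relaxation]). It is used twice. On the iterates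
    themselves it shows that velocities are within O(1 / (1 + tau)) of the
    conserved mean velocity, and that the energy exchange terms are
    O(1 / (1 + tau)) ([velocity_relaxation], [flux_relaxation]). On the difference of two
    successive sweeps, whose source is
    tau * (difference of the rates) * (exchange terms) = O(tau / (1 + tau)) times
    the last temperature increment, it supplies the second factor 1 / (1 + tau)
    ([velocity_increment], [temperature_increment]). Both increments are thus
    O(tau / (1 + tau)^2) times the last temperature increment.

    Finally tau / (1 + tau)^2 is at most (1 + z)^2 times
    dt eps / (eps + dt z)^2 ([damping_le]), for every z >= 0. The constants can
    therefore absorb the fact that, when temperatures drop, the rates of later
    sweeps may be smaller than the initial minimum that defines z. *)

(** * Antisymmetric exchange and relaxation on a finite index set *)

Section Relaxation.
Context (R : realType) (I : finType).

Lemma finite_upper (f : I -> R) : exists2 K, 0 < K & forall i, f i <= K.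
Proof.
exists (1 + \sum_i `|f i|); first by rewrite ltr_pwDl// sumr_ge0.
move=> i; apply: (le_trans (ler_norm _)).
by rewrite (bigD1 i)//= addrCA lerDl addr_ge0// sumr_ge0.
Qed.

Lemma finite_lower (f : I -> R) :
  (forall i, 0 < f i) -> exists2 c, 0 < c & forall i, c <= f i.
Proof.
move=> f0; have [K K0 hK] := finite_upper (fun i => (f i)^-1).
exists K^-1 => [|i]; first by rewrite invr_gt0.
by rewrite -[f i]invrK lef_pV2 ?posrE ?invr_gt0.
Qed.

Lemma sum_antisym (g : I -> I -> R) :
  (forall i j, g i j = - g j i) -> \sum_i \sum_j g i j = 0.
Proof.
move=> gN; have: \sum_i \sum_j g i j = - \sum_i \sum_j g i j.
  rewrite [in LHS]exchange_big -sumrN; apply: eq_bigr => i _.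
  by rewrite -sumrN; apply: eq_bigr => j _.
lra.
Qed.

Lemma norm_sum_le (g : I -> R) (b : R) :
  (forall i, `|g i| <= b) -> `|\sum_i g i| <= #|I|%:R * b.
Proof.
move=> gb; apply: (le_trans (ler_norm_sum _ _ _)).
by apply: (le_trans (ler_sum _ (fun i _ => gb i))); rewrite sumr_const mulr_natl.
Qed.

(** Maximum principle. At a maximum i of x all exchange terms are nonpositive,
    and since the weighted mean of x vanishes some x_j is nonpositive, so that
    exchange with this j alone contributes at most - tau c x_i. *)
Lemma relaxation_upper (c tau F : R) (w x f : I -> R) (a : I -> I -> R) :
    0 < c -> 0 <= tau -> (forall i, c <= w i) -> (forall i j, c <= a i j) ->
    \sum_i w i * x i = 0 ->
    (forall i, w i * x i = f i + tau * \sum_j a i j * (x j - x i)) ->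
    (forall i, `|f i| <= F) ->
  forall i, x i <= F / (c * (1 + tau)).
Proof.
move=> c0 t0 cw ca wx0 eqx fF i1.
have w0 i : 0 < w i by apply: lt_le_trans (cw i).
have [i _ xi] := @arg_maxP _ R I i1 xpredT x isT.
apply: (le_trans (xi i1 isT)).
have F0 : 0 <= F by apply: le_trans (fF i).
have d0 : 0 < c * (1 + tau) by rewrite mulr_gt0// ltr_pwDl.
rewrite ler_pdivlMr//.
have [j xj] : exists j, x j <= 0.
  apply: contrapT => /forallNP npos; move: wx0.
  apply/eqP; rewrite gt_eqF// (bigD1 i)//= ltr_pwDl//.
    by rewrite mulr_gt0//; case: (lerP (x i) 0) => // /(npos i).
  apply: sumr_ge0 => k _; rewrite mulr_ge0 ?ltW//.
  by case: (lerP (x k) 0) => // /(npos k).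
have [xi0|xi0] := lerP (x i) 0.
  by apply: le_trans F0; rewrite mulr_le0_ge0// ltW.
(* every exchange term at the maximum is nonpositive; the one with j alone
   already gives the damping *)
have ex : \sum_k a i k * (x k - x i) <= - (c * x i).
  rewrite (bigD1 j)//=.
  have : \sum_(k | k != j) a i k * (x k - x i) <= 0.
    apply: sumr_le0 => k _; rewrite mulr_ge0_le0 ?subr_le0//; last exact: xi.
    exact: le_trans (ltW c0) (ca i k).
  have : a i j * (x j - x i) <= c * (x j - x i).
    by apply: ler_wnM2r; [rewrite subr_le0; exact: xi | exact: ca].
  have : c * x j <= 0 by rewrite mulr_ge0_le0// ltW.
  lra.
have : tau * \sum_k a i k * (x k - x i) <= tau * - (c * x i).
  by rewrite ler_wpM2l.
have : c * x i <= w i * x i by rewrite ler_wpM2r// ltW.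
have := ler_norm (f i); have := fF i; have := eqx i.
lra.
Qed.

(** Antisymmetry of the exchange terms conserves the weighted mean of y, so
    x - yb has weighted mean zero and [relaxation_upper] applies to it and to
    its opposite. The antisymmetric g collects sources that are themselves
    exchanges, which is why they do not move the mean. *)
Lemma relaxation (c tau F : R) (w x y : I -> R) (a g : I -> I -> R) :
    0 < c -> 0 <= tau -> (forall i, c <= w i) -> (forall i j, c <= a i j) ->
    (forall i j, a i j = a j i) -> (forall i j, g i j = - g j i) ->
    (forall i, w i * (x i - y i) = tau * \sum_j (a i j * (x j - x i) + g i j)) ->
    let yb := (\sum_i w i * y i) / \sum_i w i in
    (forall i, `|w i * (y i - yb) + tau * \sum_j g i j| <= F) ->
  forall i, `|x i - yb| <= F / (c * (1 + tau)).
Proof.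
move=> c0 t0 cw ca aC gN eqx yb fF i0.
have w0 i : 0 < w i by apply: lt_le_trans (cw i).
have W0 : 0 < \sum_i w i.
  by rewrite (bigD1 i0)//= ltr_pwDl// sumr_ge0// => i _; rewrite ltW.
have cons : \sum_i w i * (x i - y i) = 0.
  rewrite (eq_bigr _ (fun i _ => eqx i)) -mulr_sumr sum_antisym ?mulr0// => i j.
  by rewrite aC gN; ring.
have mean0 : \sum_i w i * (x i - yb) = 0.
  have -> : \sum_i w i * (x i - yb)
      = \sum_i w i * (x i - y i) + \sum_i w i * y i - yb * \sum_i w i.
    by rewrite mulr_sumr -big_split -sumrB; apply: eq_bigr => i _ /=; ring.
  by rewrite cons /yb; field; rewrite gt_eqF.
pose f i := w i * (y i - yb) + tau * \sum_j g i j.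
have eqz i : w i * (x i - yb)
    = f i + tau * \sum_j a i j * ((x j - yb) - (x i - yb)).
  have -> : w i * (x i - yb) = w i * (x i - y i) + w i * (y i - yb) by ring.
  rewrite eqx big_split /= /f mulrDr.
  under [in RHS]eq_bigr do rewrite opprB addrA subrK.
  ring.
rewrite ler_norml; apply/andP; split; last first.
  exact: (relaxation_upper (f := f) (a := a) (x := fun i => x i - yb)).
rewrite lerNl.
apply: (relaxation_upper (f := \- f) (a := a) (w := w)
         (x := fun i => - (x i - yb)) c0 t0) => //.
- by under eq_bigr do rewrite mulrN; rewrite sumrN mean0 oppr0.
- move=> i /=; rewrite mulrN eqz opprD -mulrN -sumrN.
  congr (_ + tau * _); apply: eq_bigr => j _; ring.
- by move=> i /=; rewrite normrN; exact: fF.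
Qed.

(** The form taken by the difference of two sweeps with the same old time
    level: the data y cancel, and only the exchange source g remains. *)
Lemma relaxation_increment (c tau b : R) (w x : I -> R) (a g : I -> I -> R) :
    0 < c -> 0 <= tau -> (forall i, c <= w i) -> (forall i j, c <= a i j) ->
    (forall i j, a i j = a j i) -> (forall i j, g i j = - g j i) ->
    (forall i, w i * x i = tau * \sum_j (a i j * (x j - x i) + g i j)) ->
    (forall i j, `|g i j| <= b) ->
  forall i, `|x i| <= tau * (#|I|%:R * b) / (c * (1 + tau)).
Proof.
move=> c0 t0 cw ca aC gN eqx gb i.
have mean0 : (\sum_i w i * 0) / \sum_i w i = 0.
  by rewrite big1 ?mul0r// => j _; rewrite mulr0.
have := @relaxation c tau (tau * (#|I|%:R * b)) w x (fun=> 0) a g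
  c0 t0 cw ca aC gN.
rewrite /= mean0 => rel; rewrite -[x i]subr0; apply: rel => j.
  by rewrite subr0.
by rewrite subrr mulr0 add0r normrM (ger0_norm t0) ler_wpM2l// norm_sum_le.
Qed.

Lemma sumsq_lipschitz (M delta : R) (x y : I -> R) :
    (forall k, `|x k| <= M) -> (forall k, `|y k| <= M) ->
    (forall k, `|x k - y k| <= delta) ->
  `|\sum_k x k ^+ 2 - \sum_k y k ^+ 2| <= #|I|%:R * (2 * M * delta).
Proof.
move=> xM yM xy; rewrite -sumrB; apply: norm_sum_le => k.
rewrite subr_sqr normrM mulrC ler_pM//.
by apply: (le_trans (ler_normD _ _)); rewrite mulr_natl mulr2n lerD.
Qed.

End Relaxation.

(** * Collision coefficients *)

Section Coefficients.
Context (R : realType) (N : nat) (m dia n : 'I_N -> R).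
Context (hm : forall k, 0 < m k) (hdia : forall k, 0 < dia k).
Context (hn : forall k, 0 < n k).
Implicit Types (T : 'cV[R]_N) (i j k : 'I_N).

Lemma ccoef_gt0 i j : 0 < ccoef m dia i j.
Proof.
rewrite /ccoef; have := pi_gt0 R; move: pi => p p0.
by rewrite !(mulr_gt0, invr_gt0, exprn_gt0, addr_gt0, powR_gt0, ltr0n).
Qed.

Lemma ccoefC i j : ccoef m dia i j = ccoef m dia j i.
Proof. by rewrite /ccoef (mulrC (m i)) (addrC (m i)) (addrC (dia i)). Qed.

Lemma PsiC T i j : Psi m T i j = Psi m T j i.
Proof. by rewrite /Psi addrC. Qed.

Lemma Psi_ge0 T i j : 0 <= Psi m T i j.
Proof. exact: sqrtr_ge0. Qed.

Definition Bweight i j : R := n i * n j * ccoef m dia i j / 2.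

Definition Aweight i j : R := 2 * (m i * m j) / (m i + m j) * Bweight i j.

Lemma Bweight_gt0 i j : 0 < Bweight i j.
Proof. by rewrite /Bweight !(ccoef_gt0, mulr_gt0, invr_gt0, ltr0n). Qed.

Lemma Aweight_gt0 i j : 0 < Aweight i j.
Proof.
by rewrite /Aweight !(Bweight_gt0, mulr_gt0, invr_gt0, addr_gt0, ltr0n).
Qed.

Lemma BweightC i j : Bweight i j = Bweight j i.
Proof. by rewrite /Bweight ccoefC (mulrC (n i)). Qed.

Lemma AweightC i j : Aweight i j = Aweight j i.
Proof. by rewrite /Aweight BweightC (mulrC (m i)) (addrC (m i)). Qed.

Lemma BmxE T i j : Bmx m dia n T i j = Bweight i j * Psi m T i j.
Proof.
rewrite mxE /lambda (PsiC T j i) (ccoefC j i) /Bweight.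
have [->|p0] := eqVneq (Psi m T i j) 0; first by rewrite !mulr0 !mul0r.
have := hn i; have := hn j; have := ccoef_gt0 i j.
move: (ccoef _ _ _ _) (Psi _ _ _ _) p0 (n i) (n j) => c p p0 ni nj c0 nj0 ni0.
have -> : ni * (c * nj * p) + nj * (c * ni * p) = 2 * (ni * nj * c * p) by ring.
by field; rewrite ?p0 ?gt_eqF.
Qed.

Lemma AmxE T i j : Amx m dia n T i j = Aweight i j * Psi m T i j.
Proof.
rewrite mxE /lambda /rho (PsiC T j i) (ccoefC j i) /Aweight /Bweight.
have [->|p0] := eqVneq (Psi m T i j) 0; first by rewrite !mulr0 !mul0r.
have := hn i; have := hn j; have := ccoef_gt0 i j; have := hm i; have := hm j.
move: (ccoef _ _ _ _) (Psi _ _ _ _) p0 (n i) (n j) (m i) (m j).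
move=> c p p0 ni nj mi mj mj0 mi0 c0 nj0 ni0.
have -> : mi * ni * (c * nj * p) + mj * nj * (c * ni * p)
  = (mi + mj) * (ni * nj * c * p) by ring.
by field; rewrite ?p0 ?gt_eqF// addr_gt0.
Qed.

Lemma AmxC T i j : Amx m dia n T i j = Amx m dia n T j i.
Proof. by rewrite !AmxE AweightC PsiC. Qed.

Lemma BmxC T i j : Bmx m dia n T i j = Bmx m dia n T j i.
Proof. by rewrite !BmxE BweightC PsiC. Qed.

Lemma Bmx_ge0 T i j : 0 <= Bmx m dia n T i j.
Proof. by rewrite BmxE mulr_ge0 ?Psi_ge0// ltW// Bweight_gt0. Qed.

Lemma AmxEB T i j :
  Amx m dia n T i j = 2 * (m i * m j) / (m i + m j) * Bmx m dia n T i j.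
Proof. by rewrite AmxE BmxE /Aweight; ring. Qed.

(** The weights contain the common factor n_i n_j c_ij, so the mixture velocity
    is the centre-of-mass velocity of a pair of particles. *)
Lemma umixE d (U : 'M[R]_(N, d)) i j (k : 'I_d) :
  umix m dia n U i j 0 k = (m i * U i k + m j * U j k) / (m i + m j).
Proof.
rewrite /umix /rho !mxE (ccoefC j i).
have := hn i; have := hn j; have := ccoef_gt0 i j; have := hm i; have := hm j.
move: (ccoef _ _ _ _) (n i) (n j) (m i) (m j).
move=> c ni nj mi mj mj0 mi0 c0 nj0 ni0.
have -> : mi * ni * (c * nj) + mj * nj * (c * ni) = (mi + mj) * (ni * nj * c).
  by ring.
by field; rewrite ?gt_eqF// addr_gt0.
Qed.

Lemma SmixC d (U : 'M[R]_(N, d)) i j : Smix m dia n U i j = Smix m dia n U j i.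
Proof.
rewrite /Smix /sqnorm; apply: eq_bigr => k _.
by rewrite !umixE addrC (addrC (m i)).
Qed.

Lemma sqrt_lipschitz (y0 x y : R) : 0 < y0 -> y0 <= x -> y0 <= y ->
  `|Num.sqrt x - Num.sqrt y| <= `|x - y| / Num.sqrt y0.
Proof.
move=> y00 xy0 yy0.
have x0 : 0 <= x by apply: le_trans xy0; apply: ltW.
have y0' : 0 <= y by apply: le_trans yy0; apply: ltW.
rewrite ler_pdivlMr ?sqrtr_gt0//.
rewrite -{2}(sqr_sqrtr x0) -{2}(sqr_sqrtr y0') subr_sqr normrM ler_wpM2l//.
rewrite ger0_norm ?addr_ge0 ?sqrtr_ge0//.
by apply: ler_wpDr; rewrite ?sqrtr_ge0// ler_wsqrtr.
Qed.

(** Psi is the square root of a linear function of the temperatures that is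
    bounded away from 0 when they are; this covers A and B at once. *)
Lemma kernel_bounds (q : 'I_N -> 'I_N -> R) (t M : R) :
    (forall i j, 0 < q i j) -> 0 < t ->
  exists c K : R, [/\ 0 < c, 0 < K,
    forall T, (forall k, t <= T k 0) -> forall i j, c <= q i j * Psi m T i j,
    forall T, (forall k, T k 0 <= M) -> forall i j, q i j * Psi m T i j <= K &
    forall T T' (D : R), (forall k, t <= T k 0) -> (forall k, t <= T' k 0) ->
      (forall k, `|T k 0 - T' k 0| <= D) ->
      forall i j, `|q i j * Psi m T i j - q i j * Psi m T' i j| <= K * D].
Proof.
move=> q0 t0; pose y0 i j : R := t / m i + t / m j.
have y00 i j : 0 < y0 i j by rewrite addr_gt0// divr_gt0.
have [c c0 hc] := @finite_lower R ('I_N * 'I_N)%type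
  (fun p => q p.1 p.2 * Num.sqrt (y0 p.1 p.2))
  (fun p => mulr_gt0 (q0 _ _) (eq_trans (sqrtr_gt0 _) (y00 _ _))).
have [K1 K10 hK1] := @finite_upper R ('I_N * 'I_N)%type
  (fun p => q p.1 p.2 * Num.sqrt (M / m p.1 + M / m p.2)).
have [K2 K20 hK2] := @finite_upper R ('I_N * 'I_N)%type
  (fun p => q p.1 p.2 * (((m p.1)^-1 + (m p.2)^-1) / Num.sqrt (y0 p.1 p.2))).
have mono T i j : (forall k, t <= T k 0) -> y0 i j <= T i 0 / m i + T j 0 / m j.
  by move=> hT; rewrite lerD// ler_wpM2r// invr_ge0 ltW.
exists c, (K1 + K2); split => //; first exact: addr_gt0.
- move=> T hT i j; apply: (le_trans (hc (i, j))); rewrite /Psi /=.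
  by rewrite ler_pM2l// ler_wsqrtr// mono.
- move=> T hT i j; apply: (@le_trans _ _ K1); last by rewrite lerDl ltW.
  apply: le_trans (hK1 (i, j)); rewrite /Psi /=.
  by rewrite ler_pM2l// ler_wsqrtr// lerD// ler_wpM2r// invr_ge0 ltW.
- move=> T T' D hT hT' hD i j.
  have D0 : 0 <= D by apply: le_trans (hD i).
  rewrite -mulrBr normrM gtr0_norm//.
  apply: (@le_trans _ _ (K2 * D)); last by rewrite ler_wpM2r// lerDr ltW.
  apply: le_trans (ler_wpM2r D0 (hK2 (i, j))) => /=.
  rewrite -mulrA ler_pM2l//.
  apply: (le_trans (sqrt_lipschitz (y00 i j) (mono _ i j hT) (mono _ i j hT'))).
  rewrite mulrAC ler_wpM2r ?invr_ge0 ?sqrtr_ge0//.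
  have -> : T i 0 / m i + T j 0 / m j - (T' i 0 / m i + T' j 0 / m j)
     = (m i)^-1 * (T i 0 - T' i 0) + (m j)^-1 * (T j 0 - T' j 0) by ring.
  apply: (le_trans (ler_normD _ _)).
  have nV k : `|(m k)^-1| = (m k)^-1 by rewrite gtr0_norm ?invr_gt0.
  by rewrite !normrM !nV mulrDl lerD// ler_pM2l// invr_gt0.
Qed.

End Coefficients.

(** * The iteration as an exchange system *)

Section Exchange.
Context (R : realType) (N d : nat) (hd : (0 < d)%N) (m dia n : 'I_N -> R).
Context (hm : forall k, 0 < m k) (hdia : forall k, 0 < dia k).
Context (hn : forall k, 0 < n k).
Context (Un : 'M[R]_(N, d)) (Tn : 'cV[R]_N) (tmin : R).
Context (tmin0 : 0 < tmin) (hTn : forall k, tmin <= Tn k 0).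
Implicit Types (T : nat -> 'cV[R]_N) (U : nat -> 'M[R]_(N, d)).

Let A := Amx m dia n.
Let B := Bmx m dia n.

(** Twice the energy of one particle of species i. *)
Definition energy (V : 'M[R]_(N, d)) (S : 'cV[R]_N) (i : 'I_N) : R :=
  m i * sq_speed V i + d%:R * S i 0.

(** Energy exchange between i and j per unit of B: temperature and kinetic
    parts of the energy equation combined. *)
Definition flux (V : 'M[R]_(N, d)) (S : 'cV[R]_N) (i j : 'I_N) : R :=
  energy V S j - energy V S i + (m i - m j) * Smix m dia n V i j.

(** The quadratic terms of the energy equation are absorbed in [energy], which
    makes both equations linear exchanges up to the source in S; only the ratio
    tau = dt / eps enters. *)
Record exchange_iterates (tau : R) U T : Prop := {
  exchange_U0 : U 0%N = Un;
  exchange_T0 : T 0%N = Tn;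
  exchange_momentum : forall l i k,
    rho m n i * (U l.+1 i k - Un i k)
    = tau * \sum_j A (T l) i j * (U l.+1 j k - U l.+1 i k);
  exchange_energy : forall l i,
    n i * (energy (U l.+1) (T l.+1) i - energy Un Tn i)
    = tau * \sum_j B (T l) i j * flux (U l.+1) (T l.+1) i j }.

Lemma sq_speedE (V : 'M[R]_(N, d)) i : sq_speed V i = \sum_k V i k ^+ 2.
Proof. by apply: eq_bigr => k _; rewrite mxE. Qed.

Lemma SmixE (V : 'M[R]_(N, d)) i j :
  Smix m dia n V i j
  = \sum_k ((m i * V i k + m j * V j k) / (m i + m j)) ^+ 2.
Proof. by apply: eq_bigr => k _; rewrite umixE. Qed.

Lemma sum_laplacian (a : 'I_N -> R) (x : 'I_N -> R) i :
  \sum_j (a j - (\sum_k a k) *+ (i == j)) * x j = \sum_j a j * (x j - x i).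
Proof.
under eq_bigr do rewrite mulrBl.
under [RHS]eq_bigr do rewrite mulrBr.
rewrite !sumrB -mulr_suml; congr (_ - _); move: (\sum_k a k) => s.
rewrite (bigD1 i)//= eqxx mulr1n big1 ?addr0// => j /negPf ji.
by rewrite eq_sym ji mul0r.
Qed.

Lemma GST_exchange (dt eps : R) U T : 0 < dt -> 0 < eps ->
  GST_iterates m dia n dt eps Un Tn U T -> exchange_iterates (dt / eps) U T.
Proof.
move=> dt0 eps0 [U0 T0 hmom hen]; split => //.
- move=> l i k; have /(congr1 (fun v : 'rV[R]_d => v 0 k)) := hmom l i.
  have -> : (eps^-1 *: \sum_j (Amx m dia n (T l) i j - Dmx m dia n (T l) i j)
                *: row j (U l.+1)) 0 k
      = eps^-1 * \sum_j A (T l) i j * (U l.+1 j k - U l.+1 i k).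
    rewrite mxE summxE -sum_laplacian; congr (_ * _); apply: eq_bigr => j _.
    by rewrite [LHS]mxE; congr (_ * _); [congr (_ - _)|]; exact: mxE.
  rewrite !mxE => e; have -> : rho m n i * (U l.+1 i k - Un i k)
      = dt * (rho m n i * (dt^-1 * (U l.+1 i k - Un i k))) by field; rewrite gt_eqF.
  by rewrite e mulrA.
- move=> l i; have := hen l i.
  have -> : \sum_j (Bmx m dia n (T l) i j - Fmx m dia n (T l) i j) * T l.+1 j 0
      = \sum_j B (T l) i j * (T l.+1 j 0 - T l.+1 i 0).
    rewrite -sum_laplacian; apply: eq_bigr => j _; congr ((_ - _) * _).
    exact: mxE.
  move=> e; rewrite /energy.
  transitivity (dt * (rho m n i * ((sq_speed (U l.+1) i - sq_speed Un i) / dt)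
      + d%:R * n i * ((T l.+1 i 0 - Tn i 0) / dt))).
    by rewrite /rho; field; rewrite gt_eqF.
  rewrite e mulrDr !mulrA !mulr_sumr -big_split; apply: eq_bigr => j _ /=.
  by rewrite /flux /energy /B; ring.
Qed.

Lemma rho_gt0 i : 0 < rho m n i. Proof. exact: mulr_gt0. Qed.

Lemma AC S i j : A S i j = A S j i. Proof. exact: AmxC. Qed.
Lemma BC S i j : B S i j = B S j i. Proof. exact: BmxC. Qed.

Lemma fluxN V S i j : flux V S i j = - flux V S j i.
Proof. by rewrite /flux SmixC //; ring. Qed.

Lemma energy_conservation tau U T l : exchange_iterates tau U T ->
  \sum_i n i * energy (U l) (T l) i = \sum_i n i * energy Un Tn i.
Proof.
move=> [U0 T0 _ hen]; case: l => [|l]; first by rewrite U0 T0.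
apply/eqP; rewrite -subr_eq0 -sumrB.
under eq_bigr do rewrite -mulrBr hen.
rewrite -mulr_sumr sum_antisym ?mulr0// => i j.
by rewrite BC fluxN mulrN.
Qed.

(** The first term on the right is the kinetic energy that i receives from the
    momentum exchange with j, since the factor in front of the sum is
    2 A_ij / B_ij. The second one is frictional heating; that it is nonnegative
    makes the minimum principle for the temperatures work. *)
Lemma pair_heating (V : 'M[R]_(N, d)) i j :
  m j * sq_speed V j - m i * sq_speed V i + (m i - m j) * Smix m dia n V i j
  = 2 * (2 * (m i * m j) / (m i + m j)) * \sum_k V i k * (V j k - V i k)
    + m i * m j * (m i + 3 * m j) / (m i + m j) ^+ 2
      * \sum_k (V j k - V i k) ^+ 2.
Proof.
have M0 : m i + m j != 0 by rewrite gt_eqF// addr_gt0.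
rewrite !sq_speedE SmixE !mulr_sumr -sumrB -!big_split; apply: eq_bigr => k _ /=.
by field.
Qed.

(** At a minimum i of the new temperatures, the heat exchange and the frictional
    heating h_j are nonnegative, and so is the numerical dissipation
    rho_i |u_i - u_i^n|^2 of the implicit step. *)
Lemma temperature_ge tau U T l i : 0 < tau -> exchange_iterates tau U T ->
  tmin <= T l i 0.
Proof.
move=> tau0 [U0 T0 hmom hen]; case: l => [|l]; first by rewrite T0.
have [i1 _ Ti1] := @arg_minP _ R 'I_N i xpredT (fun i => T l.+1 i 0) isT.
apply: le_trans (Ti1 i isT); apply: le_trans (hTn i1) _.
move: i1 Ti1 => {}i Ti.
have d0 : 0 < d%:R :> R by rewrite ltr0n.
pose h j := B (T l) i j * (d%:R * (T l.+1 j 0 - T l.+1 i 0)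
   + m i * m j * (m i + 3 * m j) / (m i + m j) ^+ 2
      * \sum_k (U l.+1 j k - U l.+1 i k) ^+ 2).
have h0 j : 0 <= h j.
  apply: mulr_ge0; first exact: Bmx_ge0.
  apply: addr_ge0.
    by apply: mulr_ge0; [exact: ltW | rewrite subr_ge0; exact: Ti].
  apply: mulr_ge0; last by apply: sumr_ge0 => k _; exact: sqr_ge0.
  have mi := hm i; have mj := hm j.
  by rewrite ltW// !(mulr_gt0, invr_gt0, exprn_gt0, addr_gt0, ltr0n).
have key : n i * d%:R * (T l.+1 i 0 - Tn i 0)
   = rho m n i * (\sum_k (U l.+1 i k - Un i k) ^+ 2) + tau * \sum_j h j.
  have -> : n i * d%:R * (T l.+1 i 0 - Tn i 0)
     = n i * (energy (U l.+1) (T l.+1) i - energy Un Tn i)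
       + rho m n i * (\sum_k (U l.+1 i k - Un i k) ^+ 2)
       - 2 * \sum_k U l.+1 i k * (rho m n i * (U l.+1 i k - Un i k)).
    rewrite /energy !sq_speedE /rho.
    have -> : \sum_k U l.+1 i k * (m i * n i * (U l.+1 i k - Un i k))
      = m i * n i / 2 * (\sum_k U l.+1 i k ^+ 2 - \sum_k Un i k ^+ 2
          + \sum_k (U l.+1 i k - Un i k) ^+ 2).
      rewrite -sumrB -big_split mulr_sumr; apply: eq_bigr => k _ /=; by field.
    by field.
  rewrite hen.
  have -> : \sum_k U l.+1 i k * (rho m n i * (U l.+1 i k - Un i k))
     = tau * \sum_j A (T l) i j
               * \sum_k U l.+1 i k * (U l.+1 j k - U l.+1 i k).
    under eq_bigr do rewrite hmom mulrCA mulr_sumr.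
    rewrite -mulr_sumr exchange_big; congr (_ * _); apply: eq_bigr => j _ /=.
    by rewrite mulr_sumr; apply: eq_bigr => k _; ring.
  rewrite addrAC addrC; congr (_ + _).
  rewrite mulrCA -mulrBr; congr (_ * _).
  rewrite mulr_sumr -sumrB; apply: eq_bigr => j _.
  have e1 : flux (U l.+1) (T l.+1) i j = d%:R * (T l.+1 j 0 - T l.+1 i 0)
    + (m j * sq_speed (U l.+1) j - m i * sq_speed (U l.+1) i
       + (m i - m j) * Smix m dia n (U l.+1) i j).
    by rewrite /flux /energy; ring.
  by rewrite e1 pair_heating /h /A AmxEB// -/B; ring.
have : 0 <= n i * d%:R * (T l.+1 i 0 - Tn i 0).
  rewrite key; apply: addr_ge0; apply: mulr_ge0; rewrite ?(ltW tau0)//.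
  - by rewrite ltW// rho_gt0.
  - by apply: sumr_ge0 => k _; exact: sqr_ge0.
  - by apply: sumr_ge0 => j _; exact: h0.
by rewrite pmulr_rge0 ?mulr_gt0// subr_ge0.
Qed.

(** All terms of the conserved energy are nonnegative once temperatures are, so
    each of them is bounded by the initial total. *)
Lemma iterates_bounded : exists2 M, 0 < M &
  forall tau U T, 0 < tau -> exchange_iterates tau U T ->
  forall l i, T l i 0 <= M /\ forall k, `|U l i k| <= M.
Proof.
pose E := \sum_i n i * energy Un Tn i.
have [c c0 hc] := finite_lower rho_gt0.
have [c' c'0 hc'] := finite_lower hn.
have d1 : 1 <= d%:R :> R by rewrite ler1n.
exists (1 + `|E| / c + `|E| / c') => [|tau U T tau0 it l i].
  by rewrite -addrA ltr_pwDl// addr_ge0// divr_ge0// ltW.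
have Tge k := temperature_ge l k tau0 it.
have T0 k : 0 <= T l k 0 by apply: le_trans (Tge k); exact: ltW.
have s0 k : 0 <= sq_speed (U l) k.
  by rewrite sq_speedE sumr_ge0// => j _; exact: sqr_ge0.
have Ei : n i * energy (U l) (T l) i <= `|E|.
  apply: le_trans (ler_norm _); rewrite /E -(energy_conservation l it).
  rewrite (bigD1 i)//= lerDl sumr_ge0// => j _.
  by rewrite mulr_ge0 ?(ltW (hn j))// addr_ge0 ?mulr_ge0// ltW.
have Ts : c' * T l i 0 + c * sq_speed (U l) i <= `|E|.
  apply: le_trans Ei; rewrite mulrDr mulrA (mulrC (n i)) addrC -/(rho m n i).
  apply: lerD; first exact: ler_wpM2r.
  rewrite mulrA; apply: ler_wpM2r => //.
  by apply: (le_trans (hc' i)); rewrite ler_peMr// ltW.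
have Tc : T l i 0 <= `|E| / c'.
  rewrite ler_pdivlMr// mulrC; apply: le_trans Ts.
  by rewrite lerDl mulr_ge0// ltW.
have sc : sq_speed (U l) i <= `|E| / c.
  rewrite ler_pdivlMr// mulrC; apply: le_trans Ts.
  by rewrite lerDr mulr_ge0// ltW.
split=> [|k].
  by apply: le_trans Tc _; rewrite lerDr addr_ge0// divr_ge0// ltW.
(* with x^2 <= b, x <= 1 + b *)
have uk : `|U l i k| ^+ 2 <= `|E| / c.
  apply: le_trans sc; rewrite sq_speedE (bigD1 k)//= real_normK ?num_real//.
  by rewrite lerDl sumr_ge0// => j _; exact: sqr_ge0.
have : 0 <= `|E| / c' by rewrite divr_ge0// ltW.
by move: (normr_ge0 (U l i k)) uk; nra.
Qed.

(** * Decay towards equilibrium *)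

Lemma collision_bounds (M : R) : exists c K : R, [/\ 0 < c /\ 0 < K,
  forall i, c <= rho m n i /\ c <= n i,
  forall S : 'cV[R]_N, (forall k, tmin <= S k 0) ->
    forall i j, c <= A S i j /\ c <= B S i j,
  forall S : 'cV[R]_N, (forall k, S k 0 <= M) -> forall i j, B S i j <= K &
  forall (S S' : 'cV[R]_N) (D : R),
    (forall k, tmin <= S k 0) -> (forall k, tmin <= S' k 0) ->
    (forall k, `|S k 0 - S' k 0| <= D) ->
    forall i j, `|A S i j - A S' i j| <= K * D
             /\ `|B S i j - B S' i j| <= K * D].
Proof.
have [c1 c10 hc1] := finite_lower rho_gt0.
have [c2 c20 hc2] := finite_lower hn.
have [c3 [K3 [c30 K30 hA _ LA]]] :=
  kernel_bounds hm M (Aweight_gt0 hm hdia hn) tmin0.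
have [c4 [K4 [c40 K40 hB hK LB]]] :=
  kernel_bounds hm M (Bweight_gt0 hm hdia hn) tmin0.
pose c := Num.min (Num.min c1 c2) (Num.min c3 c4).
exists c, (K3 + K4); split.
- by split; [rewrite !lt_min c10 c20 c30 c40 | exact: addr_gt0].
- move=> i; split.
    by apply: le_trans (hc1 i); rewrite /c !ge_min lexx.
  by apply: le_trans (hc2 i); rewrite /c !ge_min lexx orbT.
- move=> S hS i j; rewrite /A /B AmxE// BmxE//; split.
    by apply: le_trans (hA S hS i j); rewrite /c !ge_min lexx orbT.
  by apply: le_trans (hB S hS i j); rewrite /c !ge_min lexx !orbT.
- move=> S hS i j; rewrite /B BmxE//; apply: (le_trans (hK S hS i j)).
  by rewrite lerDr ltW.
- move=> S S' D hS hS' hD i j; rewrite /A /B !AmxE// !BmxE//.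
  have D0 : 0 <= D by apply: le_trans (hD i).
  split; [apply: (le_trans (LA S S' D hS hS' hD i j))
         | apply: (le_trans (LB S S' D hS hS' hD i j))].
    by rewrite ler_wpM2r// lerDl ltW.
  by rewrite ler_wpM2r// lerDr ltW.
Qed.

Lemma Smix_lipschitz (M delta : R) (V V' : 'M[R]_(N, d)) i j :
    (forall i k, `|V i k| <= M) -> (forall i k, `|V' i k| <= M) ->
    (forall i k, `|V i k - V' i k| <= delta) ->
  `|Smix m dia n V i j - Smix m dia n V' i j| <= d%:R * (2 * M * delta).
Proof.
move=> hV hV' hd'; rewrite !SmixE -[d in d%:R]card_ord.
have mij : 0 < m i + m j by rewrite addr_gt0.
(* the mixture velocity is a convex combination *)
have cvx (x y b : R) : `|x| <= b -> `|y| <= b ->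
    `|(m i * x + m j * y) / (m i + m j)| <= b.
  move=> xb yb; rewrite normrM normfV (gtr0_norm mij) ler_pdivrMr//.
  apply: (le_trans (ler_normD _ _)).
  by rewrite !normrM !(gtr0_norm (hm _)) mulrDr !(mulrC b) lerD// ler_pM2l.
apply: sumsq_lipschitz => k; try exact: cvx.
by rewrite -mulrBl opprD addrACA -!mulrBr; exact: cvx.
Qed.

Lemma sq_speed_lipschitz (M delta : R) (V V' : 'M[R]_(N, d)) i :
    (forall i k, `|V i k| <= M) -> (forall i k, `|V' i k| <= M) ->
    (forall i k, `|V i k - V' i k| <= delta) ->
  `|sq_speed V i - sq_speed V' i| <= d%:R * (2 * M * delta).
Proof.
move=> hV hV' hd'; rewrite !sq_speedE -[d in d%:R]card_ord.
exact: sumsq_lipschitz.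
Qed.

(** Conserved by the iteration. It is a matrix with equal rows so that it can be
    compared with the iterates by [Smix_lipschitz]. *)
Definition mean_velocity : 'M[R]_(N, d) :=
  \matrix_(i, k) ((\sum_j rho m n j * Un j k) / \sum_j rho m n j).

Lemma velocity_relaxation : exists2 C, 0 < C &
  forall tau U T, 0 < tau -> exchange_iterates tau U T ->
  forall l i k, `|U l.+1 i k - mean_velocity i k| <= C / (1 + tau).
Proof.
have [c [_ [[c0 _] cw ca _ _]]] := collision_bounds 0.
have [F F0 hF] := @finite_upper R ('I_N * 'I_d)%type
  (fun p => `|rho m n p.1 * (Un p.1 p.2 - mean_velocity p.1 p.2)|).
exists (F / c) => [|tau U T tau0 it l i k]; first exact: divr_gt0.
rewrite -mulrA -invfM mxE.
apply: (relaxation (w := rho m n) (x := fun i => U l.+1 i k)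
  (y := fun i => Un i k) (a := A (T l)) (g := fun _ _ => 0)) => //.
- exact: ltW.
- by move=> i'; have [] := cw i'.
- by move=> i' j'; have [] := ca _ (fun k => temperature_ge l k tau0 it) i' j'.
- by move=> i' j'; exact: AC.
- by move=> *; rewrite oppr0.
- move=> i'; rewrite (exchange_momentum it); congr (_ * _).
  by apply: eq_bigr => j' _; rewrite addr0.
- move=> i'; rewrite [X in tau * X]big1// mulr0 addr0; have := hF (i', k).
  by rewrite mxE.
Qed.

(** At equilibrium the species share the temperature and the velocity, but not
    the energies e_i. The kinetic energy of the mean velocity is therefore
    subtracted: for e'_i = e_i - m_i |ub|^2, the exchange term becomes
    e'_j - e'_i + (m_i - m_j) (S_ij - |ub|^2), where the last part is
    O(1 / (1 + tau)) by [velocity_relaxation] and acts as the source. *)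
Lemma flux_relaxation : exists2 C, 0 < C &
  forall tau U T, 0 < tau -> exchange_iterates tau U T ->
  forall l i j, `|flux (U l.+1) (T l.+1) i j| <= C / (1 + tau).
Proof.
have [M M0 hM] := iterates_bounded.
have [M' M'0 hM'] := @finite_upper R ('I_N * 'I_d)%type
  (fun p => `|mean_velocity p.1 p.2|).
have [c [K [[c0 K0] cw ca aK _]]] := collision_bounds (Num.max M (M + M')).
have [Cu Cu0 hCu] := velocity_relaxation.
have [Km Km0 hKm] := @finite_upper R ('I_N * 'I_N)%type
  (fun p => `|m p.1 - m p.2|).
pose sb i := Smix m dia n mean_velocity i i.
pose gn i := energy Un Tn i - m i * sb i.
have [F0 F00 hF0] := finite_upper
  (fun i => `|n i * (gn i - (\sum_i n i * gn i) / \sum_i n i)|).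
pose Cs := d%:R * (2 * (M + M') * Cu).
have Cs0 : 0 < Cs by rewrite !mulr_gt0 ?ltr0n ?addr_gt0.
exists (2 * ((F0 + N%:R * (K * (Km * Cs))) / c) + Km * Cs).
  apply: addr_gt0; last exact: mulr_gt0.
  rewrite mulr_gt0// divr_gt0// ltr_pwDl// mulr_ge0//.
  by rewrite mulr_ge0 ?(ltW K0)// mulr_ge0 ?(ltW Km0) ?(ltW Cs0).
move=> tau U T tau0 it l i j.
have t1 : 0 < 1 + tau by rewrite addr_gt0.
have sbE i' j' : Smix m dia n mean_velocity i' j' = sb i.
  rewrite /sb !SmixE; apply: eq_bigr => k _.
  have mE i1 : mean_velocity i1 k = mean_velocity i k by rewrite !mxE.
  rewrite (mE i') (mE j').
  by congr (_ ^+ 2); field; rewrite !gt_eqF ?addr_gt0.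
have sbC i' : sb i' = sb i by exact: sbE.
have hS i' j' : `|Smix m dia n (U l.+1) i' j' - sb i| <= Cs / (1 + tau).
  rewrite -(sbE i' j').
  have -> : Cs / (1 + tau) = d%:R * (2 * (M + M') * (Cu / (1 + tau))).
    by rewrite /Cs; ring.
  apply: Smix_lipschitz => [i1 k|i1 k|i1 k]; last exact: (hCu _ _ _ tau0 it).
    by have [_ /(_ k)] := hM _ _ _ tau0 it l.+1 i1; lra.
  by have := hM' (i1, k); rewrite /=; lra.
pose e i' := energy (U l.+1) (T l.+1) i' - m i' * sb i'.
pose dS i' j' := (m i' - m j') * (Smix m dia n (U l.+1) i' j' - sb i).
have dSb i' j' : `|dS i' j'| <= Km * Cs / (1 + tau).
  by rewrite normrM -mulrA ler_pM//; exact: (hKm (i', j')).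
have fluxE i' j' : flux (U l.+1) (T l.+1) i' j' = e j' - e i' + dS i' j'.
  by rewrite /flux /e /dS !sbC; ring.
pose gb := (\sum_i n i * gn i) / \sum_i n i.
have rel i' : `|e i' - gb| <= (F0 + N%:R * (K * (Km * Cs))) / (c * (1 + tau)).
  apply: (relaxation (w := n) (x := e) (y := gn) (a := B (T l))
    (g := fun i j => B (T l) i j * dS i j)) => //.
  - exact: ltW.
  - by move=> i1; have [] := cw i1.
  - by move=> i1 j1; have [] := ca _ (fun k => temperature_ge l k tau0 it) i1 j1.
  - by move=> i1 j1; exact: BC.
  - by move=> i1 j1; rewrite BC /dS SmixC//; ring.
  - move=> i1; rewrite /e /gn opprB addrA subrK (exchange_energy it).
    by congr (_ * _); apply: eq_bigr => j1 _; rewrite fluxE mulrDr.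
  - move=> i1; apply: (le_trans (ler_normD _ _)); apply: lerD; first exact: hF0.
    rewrite normrM (gtr0_norm tau0).
    have := norm_sum_le (g := fun j => B (T l) i1 j * dS i1 j)
      (b := K * (Km * Cs / (1 + tau))).
    move=> /(_ _)/(ler_wpM2l (ltW tau0)) => h; apply: le_trans (h _) _.
      move=> j1; rewrite normrM ler_pM// ger0_norm ?Bmx_ge0//.
      apply: aK => k; rewrite le_max; apply/orP; left.
      by have [] := hM _ _ _ tau0 it l k.
    rewrite card_ord.
    have -> : tau * (N%:R * (K * (Km * Cs / (1 + tau))))
      = N%:R * (K * (Km * Cs)) * (tau / (1 + tau)) by ring.
    apply: ler_piMr; last by rewrite ler_pdivrMr// mul1r lerDr.
    by apply: mulr_ge0 => //; rewrite ltW// mulr_gt0// mulr_gt0.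
rewrite fluxE; apply: (le_trans (ler_normD _ _)).
rewrite [leRHS]mulrDl; apply: lerD; last exact: dSb.
have -> : e j - e i = (e j - gb) - (e i - gb) by ring.
apply: (le_trans (ler_normB _ _)); apply: (le_trans (lerD (rel j) (rel i))).
rewrite le_eqVlt; apply/orP; left; apply/eqP.
by field; rewrite !gt_eqF.
Qed.

(** * Increments of the iteration *)

(** The source (A^(l+1) - A^l)_ij (u_j - u_i) of the differenced equation is a
    product of the temperature increment and of a velocity difference that has
    already decayed like 1 / (1 + tau). *)
Lemma velocity_increment : exists2 C, 0 < C &
  forall tau U T, 0 < tau -> exchange_iterates tau U T ->
  forall l D, (forall i, `|T l.+1 i 0 - T l i 0| <= D) ->
  forall i k, `|U l.+2 i k - U l.+1 i k| <= C * (tau / (1 + tau) ^+ 2 * D).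
Proof.
have [c [K [[c0 K0] cw ca _ LK]]] := collision_bounds 0.
have [Cu Cu0 hCu] := velocity_relaxation.
exists (1 + N%:R * (K * (2 * Cu)) / c) => [|tau U T tau0 it l D hD i k].
  by rewrite ltr_pwDl// divr_ge0 ?(ltW c0)// !mulr_ge0// ltW.
have t1 : 0 < 1 + tau by rewrite addr_gt0.
have D0 : 0 <= D by apply: le_trans (hD i).
have Tge l' k' := temperature_ge l' k' tau0 it.
(* the 1 in the constant only makes it positive when there is no species *)
apply: (@le_trans _ _ (N%:R * (K * (2 * Cu)) / c * (tau / (1 + tau) ^+ 2 * D))).
  have -> : N%:R * (K * (2 * Cu)) / c * (tau / (1 + tau) ^+ 2 * D)
      = tau * (#|'I_N|%:R * ((K * D) * (2 * Cu / (1 + tau)))) / (c * (1 + tau)).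
    by rewrite card_ord; field; rewrite !gt_eqF.
  apply: (relaxation_increment (w := rho m n)
    (x := fun i => U l.+2 i k - U l.+1 i k) (a := A (T l.+1))
    (g := fun i j => (A (T l.+1) i j - A (T l) i j)
                     * (U l.+1 j k - U l.+1 i k))) => //.
  - exact: ltW.
  - by move=> i'; have [] := cw i'.
  - by move=> i' j'; have [] := ca (T l.+1) (Tge _) i' j'.
  - by move=> i' j'; exact: AC.
  - by move=> i' j'; rewrite !(AC _ i'); ring.
  - move=> i'.
    have -> : rho m n i' * (U l.+2 i' k - U l.+1 i' k)
      = rho m n i' * (U l.+2 i' k - Un i' k)
        - rho m n i' * (U l.+1 i' k - Un i' k) by ring.
    rewrite !(exchange_momentum it) -mulrBr -sumrB; congr (_ * _).
    by apply: eq_bigr => j' _; ring.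
  - move=> i' j'; rewrite normrM ler_pM//.
      by have [] := LK _ _ _ (Tge _) (Tge _) hD i' j'.
    have -> : U l.+1 j' k - U l.+1 i' k = (U l.+1 j' k - mean_velocity j' k)
       - (U l.+1 i' k - mean_velocity i' k) by rewrite !mxE; ring.
    apply: (le_trans (ler_normB _ _)).
    by rewrite mulr_natl mulr2n mulrDl lerD// (hCu _ _ _ tau0 it).
rewrite ler_wpM2r ?lerDr//.
by rewrite mulr_ge0// divr_ge0 ?(ltW tau0)// exprn_ge0// ltW.
Qed.

(** The energy increment is estimated like that of the velocities; its source
    has one part from the increment of B, and one from that of S, which
    [velocity_increment] controls with a factor to spare because
    tau / (1 + tau) <= 1. The temperature is recovered by subtracting the
    kinetic energy. *)
Lemma temperature_increment : exists2 C, 0 < C &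
  forall tau U T, 0 < tau -> exchange_iterates tau U T ->
  forall l D, (forall i, `|T l.+1 i 0 - T l i 0| <= D) ->
  forall i, `|T l.+2 i 0 - T l.+1 i 0| <= C * (tau / (1 + tau) ^+ 2 * D).
Proof.
have [M M0 hM] := iterates_bounded.
have [c [K [[c0 K0] cw ca aK LK]]] := collision_bounds M.
have [Cu Cu0 hCu] := velocity_increment.
have [Cf Cf0 hCf] := flux_relaxation.
have [Km Km0 hKm] := @finite_upper R ('I_N * 'I_N)%type
  (fun p => `|m p.1 - m p.2|).
have [Kn Kn0 hKn] := finite_upper m.
pose Cs := d%:R * (2 * M * Cu).
have d1 : 1 <= d%:R :> R by rewrite ler1n.
have d0 : 0 < d%:R :> R by rewrite ltr0n.
have Cs0 : 0 < Cs by rewrite !mulr_gt0.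
pose Ce := N%:R * (K * (Km * Cs) + K * Cf) / c.
have Ce0 : 0 <= Ce.
  by rewrite divr_ge0 ?(ltW c0)// mulr_ge0// addr_ge0// ltW// !mulr_gt0.
exists (Ce + Kn * Cs) => [|tau U T tau0 it l D hD i].
  by rewrite ltr_wpDl// mulr_gt0.
have t1 : 0 < 1 + tau by rewrite addr_gt0.
have D0 : 0 <= D by apply: le_trans (hD i).
have Tge l' k' := temperature_ge l' k' tau0 it.
pose q := tau / (1 + tau) ^+ 2.
have q0 : 0 <= q by rewrite divr_ge0 ?(ltW tau0)// exprn_ge0// ltW.
have qr : q <= (1 + tau)^-1.
  rewrite /q expr2 invfM mulrA ler_piMl ?invr_ge0 ?(ltW t1)//.
  by rewrite ltW// ltr_pdivrMr// mul1r ltrDr.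
have Ub l' i' k : `|U l' i' k| <= M by have [_ ->] := hM _ _ _ tau0 it l' i'.
have dU := hCu _ _ _ tau0 it l D hD.
have CsE : d%:R * (2 * M * (Cu * (q * D))) = Cs * (q * D) by rewrite /Cs; ring.
have ds i' : `|sq_speed (U l.+2) i' - sq_speed (U l.+1) i'| <= Cs * (q * D).
  by rewrite -CsE; exact: sq_speed_lipschitz.
have dS i' j' : `|Smix m dia n (U l.+2) i' j' - Smix m dia n (U l.+1) i' j'|
    <= Cs * (q * D).
  by rewrite -CsE; exact: Smix_lipschitz.
pose e l i := energy (U l) (T l) i.
have de : `|e l.+2 i - e l.+1 i| <= Ce * (q * D).
  have -> : Ce * (q * D) = tau * (#|'I_N|%:R * ((K * (Km * Cs) + K * Cf)
      * ((1 + tau)^-1 * D))) / (c * (1 + tau)).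
    by rewrite card_ord /Ce /q; field; rewrite !gt_eqF.
  apply: (relaxation_increment (w := n)
    (x := fun i => e l.+2 i - e l.+1 i) (a := B (T l.+1))
    (g := fun i j => B (T l.+1) i j * ((m i - m j)
        * (Smix m dia n (U l.+2) i j - Smix m dia n (U l.+1) i j))
      + (B (T l.+1) i j - B (T l) i j) * flux (U l.+1) (T l.+1) i j)) => //.
  - exact: ltW.
  - by move=> i'; have [] := cw i'.
  - by move=> i' j'; have [] := ca (T l.+1) (Tge _) i' j'.
  - by move=> i' j'; exact: BC.
  - move=> i' j'; rewrite !(BC _ i') (fluxN _ _ i') !(SmixC hm hdia hn _ i').
    by ring.
  - move=> i'; rewrite /e.
    have -> : n i' * (energy (U l.+2) (T l.+2) i' - energy (U l.+1) (T l.+1) i')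
      = n i' * (energy (U l.+2) (T l.+2) i' - energy Un Tn i')
        - n i' * (energy (U l.+1) (T l.+1) i' - energy Un Tn i') by ring.
    rewrite !(exchange_energy it) -mulrBr -sumrB; congr (_ * _).
    by apply: eq_bigr => j' _; rewrite /flux; ring.
  - move=> i' j'; apply: (le_trans (ler_normD _ _)).
    rewrite [leRHS]mulrDl; apply: lerD.
      have -> : K * (Km * Cs) * ((1 + tau)^-1 * D)
        = K * (Km * (Cs * ((1 + tau)^-1 * D))) by ring.
      rewrite !normrM ler_pM// ?mulr_ge0//.
        rewrite ger0_norm ?Bmx_ge0//; apply: aK => k.
        by have [] := hM _ _ _ tau0 it l.+1 k.
      rewrite ler_pM//; first exact: (hKm (i', j')).
      apply: (le_trans (dS i' j')); rewrite ler_pM2l// ler_wpM2r//.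
    rewrite normrM.
    have -> : K * Cf * ((1 + tau)^-1 * D) = (K * D) * (Cf / (1 + tau)) by ring.
    rewrite ler_pM//; last exact: (hCf _ _ _ tau0 it).
    by have [] := LK _ _ _ (Tge _) (Tge _) hD i' j'.
apply: (@le_trans _ _ (`|d%:R * (T l.+2 i 0 - T l.+1 i 0)|)).
  by rewrite normrM (gtr0_norm d0) ler_peMl.
have -> : d%:R * (T l.+2 i 0 - T l.+1 i 0) = (e l.+2 i - e l.+1 i)
   - m i * (sq_speed (U l.+2) i - sq_speed (U l.+1) i).
  by rewrite /e /energy; ring.
apply: (le_trans (ler_normB _ _)); rewrite mulrDl lerD//.
rewrite normrM (gtr0_norm (hm i)) -mulrA ler_pM// ltW//.
Qed.

End Exchange.

(** * Norms and damping factors *)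

Section Norms.
Context (R : realType).

Lemma frobenius_norm_le p q (A : 'M[R]_(p, q)) (b : R) :
    0 <= b -> (forall i j, `|A i j| <= b) ->
  frobenius_norm A <= Num.sqrt (p * q)%:R * b.
Proof.
move=> b0 hA; rewrite -[X in _ * X](ger0_norm b0) -sqrtr_sqr -sqrtrM//.
apply: ler_wsqrtr; rewrite natrM -mulrA -[p in p%:R]card_ord mulr_natl -sumr_const.
apply: ler_sum => i _; rewrite -[q in q%:R]card_ord mulr_natl -sumr_const.
apply: ler_sum => j _; rewrite -real_normK ?num_real// ler_sqr ?nnegrE//.
Qed.

Lemma euclidean_normE p (v : 'cV[R]_p) : euclidean_norm v = frobenius_norm v.
Proof.
by congr Num.sqrt; apply: eq_bigr => i _; rewrite big_ord1.
Qed.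

Lemma le_euclidean_norm p (v : 'cV[R]_p) i : `|v i 0| <= euclidean_norm v.
Proof.
rewrite -sqrtr_sqr ler_wsqrtr// (bigD1 i)//= lerDl sumr_ge0// => j _.
exact: sqr_ge0.
Qed.

(** Because eps + dt z <= (1 + z) (eps + dt). *)
Lemma damping_le (z : R) : 0 <= z -> exists2 C, 0 < C &
  forall dt eps, 0 < dt -> 0 < eps ->
  (dt / eps) / (1 + dt / eps) ^+ 2 <= C * (dt * eps / (eps + dt * z) ^+ 2).
Proof.
move=> z0; exists ((1 + z) ^+ 2) => [|dt eps dt0 eps0].
  by rewrite exprn_gt0// ltr_pwDl.
have a0 : 0 < eps + dt * z by rewrite ltr_pwDl// mulr_ge0// ltW.
have b0 : 0 < eps + dt by rewrite addr_gt0.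
have -> : dt / eps / (1 + dt / eps) ^+ 2 = dt * eps * ((eps + dt) ^-1) ^+ 2.
  by field; rewrite !gt_eqF.
have -> : (1 + z) ^+ 2 * (dt * eps / (eps + dt * z) ^+ 2)
   = dt * eps * ((1 + z) / (eps + dt * z)) ^+ 2.
  by field; rewrite !gt_eqF.
apply: ler_wpM2l; first by rewrite mulr_ge0// ltW.
have c0 : 0 <= (1 + z) / (eps + dt * z) by rewrite divr_ge0 ?(ltW a0)// addr_ge0.
rewrite ler_sqr ?nnegrE//; last by rewrite invr_ge0 ltW.
rewrite ler_pdivlMr// mulrC ler_pdivrMr//.
have : 0 <= z * eps by rewrite mulr_ge0// ltW.
lra.
Qed.

Lemma Wmx_Delta N d (m n : 'I_N -> R) (U : nat -> 'M[R]_(N, d)) l i k :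
  Delta (fun k => Wmx m n (U k)) l i k
  = Num.sqrt (rho m n i) * (U l.+1 i k - U l i k).
Proof. by rewrite /Delta /Wmx !mul_diag_mx !mxE mulrBr. Qed.

Lemma etavec_Delta N (n : 'I_N -> R) (T : nat -> 'cV[R]_N) l i :
  Delta (fun k => etavec n (T k)) l i 0
  = Num.sqrt (n i) * (T l.+1 i 0 - T l i 0).
Proof. by rewrite /Delta /etavec !mul_diag_mx !mxE mulrBr. Qed.

Lemma fmin_ge0 (I : finType) (f : I -> R) (i0 : I) :
  (forall i, 0 <= f i) -> 0 <= fmin f.
Proof. by move=> f0; have [i -> _] := fmin_attained f i0. Qed.

Lemma fmax_ge0 (I : finType) (f : I -> R) (i0 : I) :
  (forall i, 0 <= f i) -> 0 <= fmax f.
Proof. by move=> f0; have [i -> _] := fmax_attained f i0. Qed.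

End Norms.

Theorem theorem3p6 (R : realType) (N d : nat) (hN : (0 < N)%N) (hd : (0 < d)%N)
    (m dia n : 'I_N -> R)
    (hm : forall k, 0 < m k) (hdia : forall k, 0 < dia k)
    (hn : forall k, 0 < n k)
    (Un : 'M[R]_(N, d)) (Tn : 'cV[R]_N) (hTn : forall k, 0 < Tn k 0) :
  exists CW C0 C1 : R,
    [/\ 0 < CW, 0 < C0, 0 < C1 &
      forall (dt eps : R), 0 < dt -> 0 < eps ->
      forall (U : nat -> 'M[R]_(N, d)) (T : nat -> 'cV[R]_N),
        GST_iterates m dia n dt eps Un Tn U T ->
      forall l : nat, (1 <= l)%N ->
        let W k := Wmx m n (U k) in
        let eta k := etavec n (T k) in
        frobenius_norm (Delta W l)
          <= CW * GammaW m dia n Tn dt eps * euclidean_norm (Delta eta l.-1)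
        /\
        euclidean_norm (Delta eta l)
          <= C0 * GammaW m dia n Tn dt eps * euclidean_norm (Delta eta l.-1)
           + C1 * GammaX m dia n Tn dt eps * euclidean_norm (Delta eta l.-1)].
Proof.
have [tmin tmin0 tminT] := finite_lower hTn.
have rho0 i : 0 < rho m n i by exact: mulr_gt0.
have i0 : 'I_N := Ordinal hN.
have [Cu Cu0 hCu] := velocity_increment hd hm hdia hn Un tmin0 tminT.
have [Ct Ct0 hCt] := temperature_increment hd hm hdia hn Un tmin0 tminT.
have [Cg Cg0 hCg] : exists2 C, 0 < C & forall dt eps, 0 < dt -> 0 < eps ->
    (dt / eps) / (1 + dt / eps) ^+ 2 <= C * GammaW m dia n Tn dt eps.
  apply: damping_le; rewrite /zmin divr_ge0 ?mulr_ge0//.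
    apply: (fmin_ge0 (i0, i0)) => p; rewrite AmxE// mulr_ge0 ?Psi_ge0//.
    by rewrite ltW// Aweight_gt0.
  by apply: (fmax_ge0 i0) => i; rewrite ltW.
have [K K0 hK] := finite_upper
  (fun i => Num.max (Num.sqrt (rho m n i)) (Num.sqrt (n i))).
have [Kn Kn0 hKn] := finite_upper (fun i => (Num.sqrt (n i))^-1).
have hKr i : Num.sqrt (rho m n i) <= K.
  by apply: le_trans (hK i); rewrite le_max lexx.
have hKe i : Num.sqrt (n i) <= K.
  by apply: le_trans (hK i); rewrite le_max lexx orbT.
exists (Num.sqrt (N * d)%:R * (K * (Cu * (Cg * Kn)))), 1,
  (Num.sqrt (N * 1)%:R * (K * (Ct * (Cg * Kn)))).
split=> //; do ?by rewrite !mulr_gt0// sqrtr_gt0 ltr0n ?muln_gt0 ?hN ?muln1.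
move=> dt eps dt0 eps0 U T it [//|l] _ /=.
have tau0 : 0 < dt / eps by rewrite divr_gt0.
have ex := GST_exchange dt0 eps0 it.
set W := fun k => _; set eta := fun k => _.
set e := euclidean_norm (Delta eta l); set G := GammaW _ _ _ _ _ _.
have e0 : 0 <= e by exact: sqrtr_ge0.
have hD i : `|T l.+1 i 0 - T l i 0| <= Kn * e.
  have s0 : 0 < Num.sqrt (n i) by rewrite sqrtr_gt0.
  apply: (@le_trans _ _ ((Num.sqrt (n i))^-1 * e)); last exact: ler_wpM2r.
  rewrite mulrC ler_pdivlMr// mulrC -{1}(gtr0_norm s0) -normrM -etavec_Delta.
  exact: le_euclidean_norm.
have G0 : 0 <= G.
  by rewrite /G /GammaW divr_ge0 ?sqr_ge0// mulr_ge0// ltW.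
have qD : dt / eps / (1 + dt / eps) ^+ 2 * (Kn * e) <= Cg * Kn * (G * e).
  apply: (@le_trans _ _ (Cg * G * (Kn * e))).
    by rewrite ler_wpM2r ?hCg// mulr_ge0// ltW.
  by rewrite le_eqVlt; apply/orP; left; apply/eqP; ring.
have CGe0 : 0 <= Cg * Kn * (G * e).
  by apply: mulr_ge0; [rewrite ltW// mulr_gt0 | exact: mulr_ge0].
split.
  have -> : forall a, a * (K * (Cu * (Cg * Kn))) * G * e
     = a * (K * (Cu * (Cg * Kn * (G * e)))) by move=> a; ring.
  apply: frobenius_norm_le => [|i k].
    by rewrite mulr_ge0 ?(ltW K0)// mulr_ge0 ?(ltW Cu0).
  rewrite Wmx_Delta normrM (ger0_norm (sqrtr_ge0 _)) ler_pM ?sqrtr_ge0//.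
  apply: (le_trans (hCu _ _ _ tau0 ex l _ hD i k)).
  by rewrite ler_pM2l.
apply: (@le_trans _ _ (Num.sqrt (N * 1)%:R * (K * (Ct * (Cg * Kn))) * G * e)).
  have -> : forall a, a * (K * (Ct * (Cg * Kn))) * G * e
     = a * (K * (Ct * (Cg * Kn * (G * e)))) by move=> a; ring.
  rewrite euclidean_normE; apply: frobenius_norm_le => [|i k].
    by rewrite mulr_ge0 ?(ltW K0)// mulr_ge0 ?(ltW Ct0).
  rewrite ord1 etavec_Delta normrM (ger0_norm (sqrtr_ge0 _)) ler_pM ?sqrtr_ge0//.
  apply: (le_trans (hCt _ _ _ tau0 ex l _ hD i)).
  by rewrite ler_pM2l.
(* the increment is at most the summand with GammaX >= GammaW *)
apply: ler_wpDl; first by rewrite mul1r mulr_ge0.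
rewrite ler_wpM2r// ler_wpM2l//; last by rewrite /GammaX le_max lexx.
by rewrite !mulr_ge0 ?sqrtr_ge0// ltW.
Qed.
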